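(* Let $A$ and $M$ be vector spaces over a field $\mathbb{K}$ of characteristic $0$, and let $\mu\in\mathrm{Hom}(A^{\otimes 2},A)$, $l\in\mathrm{Hom}(A\otimes M,M)$, $r\in\mathrm{Hom}(M\otimes A,M)$, $T\in\mathrm{Hom}(M,A)$ be linear maps. Put $\pi=\mu+l+r\in L'_1$. Then $((A,\mu),(M,l,r),T)$ is a relative Rota-Baxter algebra if and only if $(\pi[1],T)\in(L'[1]\oplus\mathfrak a)_0$ is a Maurer-Cartan element of the $L_\infty[1]$-algebra $(L'[1]\oplus\mathfrak a,\{l_k\}_{k\ge1})$.
   Context: Relative Rota-Baxter algebra: a triple $((A,\mu),(M,l,r),T)$ where $(A,\mu)$ is an associative algebra (not necessarily unital), $(M,l,r)$ is an $A$-bimodule with left action $l(a,m)=am$ and right action $r(m,a)=ma$, and $T:M\to A$ is linear with $T(m)T(n)=T(T(m)n+mT(n))$ for all $m,n\in M$. Gerstenhaber bracket: for a vector space $V$, $f\in\mathrm{Hom}(V^{\otimes m+1},V)$, $g\in\mathrm{Hom}(V^{\otimes n+1},V)$, put $(f\diamond g)(v_1,\ldots,v_{m+n+1})=\sum_{i=1}^{m+1}(-1)^{(i-1)n}f(v_1,\ldots,v_{i-1},g(v_i,\ldots,v_{i+n}),v_{i+n+1},\ldots,v_{m+n+1})$ and $[f,g]=f\diamond g-(-1)^{mn}g\diamond f$. Then $\bigoplus_{n\ge0}\mathrm{Hom}(V^{\otimes n+1},V)$ is a graded Lie algebra with $\mathrm{Hom}(V^{\otimes n+1},V)$ in degree $n$.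 Take $V=A\oplus M$ and $L=\bigoplus_{n\ge0}\mathrm{Hom}((A\oplus M)^{\otimes n+1},A\oplus M)$. Multilinear maps defined on a tensor product of copies of $A$ and $M$ are extended by zero to $A\oplus M$. Let $L'=\bigoplus_{n\ge0}L'_n$, where $L'_n=\mathrm{Hom}(A^{\otimes n+1},A)\oplus\mathrm{Hom}(\mathcal A^{n,1},M)$ and $\mathcal A^{n,1}$ is the direct sum of all tensor products of $n$ copies of $A$ and one copy of $M$ (in any order); this is a graded Lie subalgebra of $L$. Let $\mathfrak a=\bigoplus_{n\ge0}\mathrm{Hom}(M^{\otimes n+1},A)$ with $\mathrm{Hom}(M^{\otimes n+1},A)$ in degree $n$ (an abelian subalgebra of $L$), and $P:L\to\mathfrak a$ the projection onto $\mathfrak a$. An $L_\infty[1]$-algebra is a graded vector space $W$ with degree $1$ graded symmetric multilinear maps $l_k:W^{\otimes k}\to W$, $k\ge1$, such that for all $n\ge1$, $\sum_{i+j=n+1}\sum_{\sigma\in S_{(i,n-i)}}\epsilon(\sigma)\,l_j(l_i(x_{\sigma(1)},\ldots,x_{\sigma(i)}),x_{\sigma(i+1)},\ldots,x_{\sigma(n)})=0$, with $S_{(i,n-i)}$ the $(i,n-i)$-shuffles and $\epsilon(\sigma)$ the Koszul sign. With $(L'[1])_i=L'_{i+1}$, the graded vector space $L'[1]\oplus\mathfrak a$ is an $L_\infty[1]$-algebra with operations $l_2(Q[1],Q'[1])=(-1)^{|Q|}[Q,Q'][1]$ and $l_k(Q[1],\theta_1,\ldots,\theta_{k-1})=P[\cdots[[Q,\theta_1],\theta_2],\ldots,\theta_{k-1}]$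 for $k\ge2$, for homogeneous $Q,Q'\in L'$, $\theta_i\in\mathfrak a$; up to graded-symmetric permutation of the arguments all other operations vanish. A Maurer-Cartan element is a degree $0$ element $\alpha$ with $\sum_{k\ge1}\frac1{k!}l_k(\alpha,\ldots,\alpha)=0$ (here the sum is finite). *)

(* Defs.v *)
From HB Require Import structures.
From mathcomp Require Import all_boot all_order all_algebra.
From mathcomp Require Import boolp classical_sets functions.

Set Implicit Arguments.
Unset Strict Implicit.
Unset Printing Implicit Defensive.

Import GRing.Theory.
Local Open Scope ring_scope.

Record relative_rota_baxter (K : fieldType) (A M : lmodType K)
    (mu : A -> A -> A) (l : A -> M -> M) (r : M -> A -> M) (T : M -> A) : Prop :=
  RelativeRotaBaxter {
    rrb_assoc : forall a b c, mu (mu a b) c = mu a (mu b c);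
    rrb_left : forall a b m, l (mu a b) m = l a (l b m);
    rrb_middle : forall a m b, r (l a m) b = l a (r m b);
    rrb_right : forall m a b, r (r m a) b = r m (mu a b);
    rrb_operator : forall m n, mu (T m) (T n) = T (l (T m) n + r m (T n)) }.

(* A graded vector space with operations l_k, k >= 1, on homogeneous
   elements. The grading is internal: [gr_homog d] is the subspace of degree d
   of an ambient space, and the graded space is the direct sum of these.
   [gr_op [:: (d1, x1); ..; (dk, xk)]] is l_k(x1, .., xk); only its values for
   xi of degree di are meaningful. *)
Record graded_ops (K : fieldType) := GradedOps {
  gr_carrier : lmodType K;
  gr_homog : int -> gr_carrier -> Prop;
  gr_op : seq (int * gr_carrier) -> gr_carrier }.

(* The series sum_k l_k(x, .., x) / k! has finitely many nonzero terms and its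
   sum is zero. *)
Definition maurer_cartan (K : fieldType) (W : graded_ops K)
    (x : gr_carrier W) : Prop :=
  gr_homog 0 x /\
  exists N : nat,
    (forall k, (N < k)%N -> gr_op (nseq k (0, x)) = 0) /\
    \sum_(1 <= k < N.+1) (k`!%:R : K)^-1 *: gr_op (nseq k (0, x)) = 0.

Section Gerstenhaber.
Variables (K : fieldType) (V : lmodType K).

(* Hom(V^{(x) n+1}, V): a multilinear map in n+1 arguments is encoded as a map
   on all finite sequences that vanishes on those of length different from
   n+1. *)
Definition multilin (n : nat) (f : seq V -> V) : Prop :=
  (forall s, size s != n.+1 -> f s = 0) /\
  (forall s1 s2 (c : K) u v, (size s1 + size s2 = n)%N ->
     f (s1 ++ (c *: u + v) :: s2) = c *: f (s1 ++ u :: s2) + f (s1 ++ v :: s2)).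

(* f has degree m and g has degree n; i counts the arguments of f to the left
   of g, so it is smaller by one than the usual summation index. *)
Definition circ (m n : nat) (f g : seq V -> V) : seq V -> V := fun s =>
  if size s == (m + n).+1 then
    \sum_(i < m.+1) (-1) ^+ (i * n) *:
       f (take i s ++ g (take n.+1 (drop i s)) :: drop (i + n.+1) s)
  else 0.

Definition bracket (m n : nat) (f g : seq V -> V) : seq V -> V :=
  circ m n f g - (-1) ^+ (m * n) *: circ n m g f.

(* [[..[[Q, t1], t2], ..], tk], where Q has degree q and ts lists the ti
   together with their degrees. *)
Fixpoint iter_bracket (q : nat) (Q : seq V -> V)
    (ts : seq (nat * (seq V -> V))) : seq V -> V :=
  if ts is (n, t) :: ts' then iter_bracket (q + n) (bracket q n Q t) ts' else Q.

End Gerstenhaber.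

Section LinfinityAlgebra.
Variables (K : fieldType) (A M : lmodType K).
Local Notation V := (A * M)%type.

(* Projection of A (+) M onto M (b = true) or onto A (b = false). *)
Definition slot (b : bool) (v : V) : V := if b then (0, v.2) else (v.1, 0).

(* Projection of L onto the maps from the tensor product of copies of A and M
   given by the word w (true for M) to the summand given by b, these maps being
   extended by zero. *)
Definition block (w : bitseq) (b : bool) (f : seq V -> V) : seq V -> V :=
  fun s => if size s == size w
           then slot b (f [seq slot p.1 p.2 | p <- zip w s]) else 0.

(* L'_n: words without M take values in A, words with exactly one M take values
   in M, and all other components vanish. *)
Definition Lprime (n : nat) (f : seq V -> V) : Prop :=
  multilin n f /\
  f = \sum_(w : n.+1.-tuple bool | (count id w <= 1)%N) block w (has id w) f.

Definition afrak (n : nat) (f : seq V -> V) : Prop :=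
  multilin n f /\ f = block (nseq n.+1 true) false f.

Definition projP (f : seq V -> V) : seq V -> V :=
  fun s => block (nseq (size s) true) false f s.

Local Notation ambient := ((seq V -> V) * (seq V -> V))%type.

(* (L'[1] (+) a)_d = L'_{d+1} (+) a_d, both being zero in negative degrees. *)
Definition homog (d : int) (x : ambient) : Prop :=
  (if (d + 1)%R is Posz n then Lprime n x.1 else x.1 = 0) /\
  (if d is Posz n then afrak n x.2 else x.2 = 0).

Local Notation arg := (int * ambient)%type.

(* The L'[1]-part of the operations is l_2(Q[1], Q'[1]) = (-1)^|Q| [Q, Q'][1],
   where |Q| = d + 1 if Q[1] has degree d. *)
Definition op_L (xs : seq arg) : seq V -> V :=
  if xs is [:: (d1, x1); (d2, x2)] then
    (-1) ^+ absz (d1 + 1) *: bracket (absz (d1 + 1)) (absz (d2 + 1)) x1.1 x2.1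
  else 0.

(* The a-part: xi = Qi[1] + thetai is expanded by multilinearity, and only the
   terms with exactly one argument Qj[1] and at least one thetai contribute.
   The Koszul sign comes from moving Qj[1] in front of x0, .., x_{j-1}. *)
Definition op_a (xs : seq arg) : seq V -> V :=
  if (1 < size xs)%N then
    \sum_(j < size xs)
      let: (d, x) := nth (0, 0) xs j in
      ((-1) ^ (d * \sum_(y <- take j xs) y.1) : K) *:
        projP (iter_bracket (absz (d + 1)) x.1
          [seq (absz y.1, y.2.2) | y <- take j xs ++ drop j.+1 xs])
  else 0.

Definition rrb_linfinity : graded_ops K :=
  @GradedOps K ambient homog (fun xs => (op_L xs, op_a xs)).

Definition lift_mu (mu : A -> A -> A) : seq V -> V :=
  fun s => if s is [:: u; v] then (mu u.1 v.1, 0) else 0.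

Definition lift_l (l : A -> M -> M) : seq V -> V :=
  fun s => if s is [:: u; v] then (0, l u.1 v.2) else 0.

Definition lift_r (r : M -> A -> M) : seq V -> V :=
  fun s => if s is [:: u; v] then (0, r u.2 v.1) else 0.

Definition lift_T (T : M -> A) : seq V -> V :=
  fun s => if s is [:: u] then (T u.2, 0) else 0.

End LinfinityAlgebra.

(* Main.v *)
(** The component of a Maurer-Cartan expression in [L'[1]] is [-[pi, pi] / 2],
    which vanishes iff [A] is associative and [M] is a bimodule.  For the
    component in [a], bracketing with [T] acts on binary maps by
    [D f (u, v) = f (T u, v) + f (u, T v) - T (f (u, v))].  As [T] squares to
    zero on [A (+) M], [D^3 pi = - 6 T pi (T u, T v)], which is zero because
    [pi] maps [A (x) A] to [A]; the only term left in [a] is [P (D^2 pi) / 2],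
    whose vanishing is the Rota-Baxter identity. *)

Require Import Defs.
From HB Require Import structures.
From mathcomp Require Import all_boot all_order all_algebra.
From mathcomp Require Import boolp classical_sets functions.

Set Implicit Arguments.
Unset Strict Implicit.
Unset Printing Implicit Defensive.

Import GRing.Theory.
Local Open Scope ring_scope.

Section Brackets.
Variables (K : fieldType) (V : lmodType K).
Implicit Types f g t : seq V -> V.

(** Bracketing with an element of degree 0 leaves the degree [q] unchanged, so the iterated bracket
    is a plain iterate of one operator. *)
Lemma iter_bracket_nseq0 q f t k :
  iter_bracket q f (nseq k (0%N, t)) = iter k (fun g => bracket q 0 g t) f.
Proof.
elim: k f => // k IHk f.
by rewrite iterSr /= addn0 IHk.
Qed.

Lemma circ11E f g : circ 1 1 f g = fun s =>
  if s is [:: u; v; w] then f [:: g [:: u; v]; w] - f [:: u; g [:: v; w]]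
  else 0.
Proof.
apply/funext => -[|u [|v [|w [|x s]]]] //.
by rewrite /circ /= !big_ord_recl big_ord0 /= addr0 expr0 scale1r scaleN1r.
Qed.

Lemma bracket11_id f : bracket 1 1 f f = circ 1 1 f f *+ 2.
Proof. by rewrite /bracket expr1 scaleN1r opprK mulr2n. Qed.

Lemma bracket10E f t : bracket 1 0 f t = fun s =>
  if s is [:: u; v] then
    f [:: t [:: u]; v] + f [:: u; t [:: v]] - t [:: f [:: u; v]]
  else 0.
Proof.
have subE (g h : seq V -> V) s : (g - h) s = g s - h s by [].
rewrite /bracket expr0 scale1r.
apply/funext => -[|u [|v [|w s]]]; rewrite subE /circ /= ?subr0 //.
by rewrite !big_ord_recl !big_ord0 /= !addr0 !expr0 !scale1r.
Qed.

End Brackets.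

Section Operations.
Variables (K : fieldType) (A M : lmodType K).
Local Notation V := (A * M)%type.
Implicit Type x : (seq V -> V) * (seq V -> V).

(** In degree 0 all Koszul signs are 1, so the [k.+2] choices of the argument that supplies [Q[1]]
    contribute equally. *)
Lemma op_a_nseq x k :
  op_a (nseq k.+2 (0, x)) =
    projP (iter k.+1 (fun g => bracket 1 0 g x.2) x.1) *+ k.+2.
Proof.
rewrite /op_a size_nseq (_ : 1 < k.+2)%N //.
under eq_bigr => j _.
  rewrite nth_nseq ltn_ord mul0r expr0z scale1r.
  rewrite take_nseq ?(ltnW (ltn_ord j)) // drop_nseq -nseqD.
  rewrite subSS subnKC; last by rewrite -ltnS.
  rewrite map_nseq iter_bracket_nseq0.
  over.
by rewrite sumr_const card_ord.
Qed.

Lemma op_L_nseq2 x :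
  op_L (nseq 2 (0, x)) = - (circ 1 1 x.1 x.1 *+ 2).
Proof. by rewrite /= expr1 scaleN1r bracket11_id. Qed.

Lemma projP0 : projP 0 = 0 :> (seq V -> V).
Proof.
by apply/funext => s; rewrite /projP /block size_nseq eqxx.
Qed.

End Operations.

Section RotaBaxter.
Variables (K : fieldType) (A M : lmodType K).
Variables (mu : {bilinear A -> A -> A}) (l : {bilinear A -> M -> M}).
Variables (r : {bilinear M -> A -> M}) (T : {linear M -> A}).
Local Notation V := (A * M)%type.
Local Notation pi := (lift_mu mu + lift_l l + lift_r r : seq V -> V).
Local Notation t := (lift_T T : seq V -> V).
Local Notation D := (fun g : seq V -> V => bracket 1 0 g t).

Lemma structureE : pi = fun s =>
  if s is [:: u; v] then (mu u.1 v.1, l u.1 v.2 + r u.2 v.1) else 0.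
Proof.
have addE (g h : seq V -> V) s : (g + h) s = g s + h s by [].
apply/funext => -[|u [|v [|w s]]]; rewrite !addE /= ?addr0 //.
by congr pair; rewrite /= ?addr0 ?add0r.
Qed.

Lemma bracket_T1 : iter 1 D pi = fun s =>
  if s is [:: u; v] then
    (mu (T u.2) v.1 + mu u.1 (T v.2) - T (l u.1 v.2 + r u.2 v.1),
     l (T u.2) v.2 + r u.2 (T v.2))
  else 0.
Proof.
rewrite /= bracket10E structureE; apply/funext => -[|u [|v [|w s]]] //=.
by congr pair; rewrite /= ?linear0l ?linear0r ?addr0 ?add0r ?subr0.
Qed.

Lemma bracket_T2 : iter 2 D pi = fun s =>
  if s is [:: u; v] then
    ((mu (T u.2) (T v.2) - T (l (T u.2) v.2 + r u.2 (T v.2))) *+ 2, 0)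
  else 0.
Proof.
rewrite iterS bracket_T1 bracket10E; apply/funext => -[|u [|v [|w s]]] //=.
congr pair; rewrite /= ?linear0 ?linear0l ?linear0r ?addr0 ?add0r ?subr0 //.
(* The [l] term occurs once from the slot [(T u, v)] and once from the outer [T], the [r] term once
   from [(u, T v)] and once from the outer [T]; hence the factor 2. *)
by rewrite !linearD /= [X in X + _ = _]addrACA mulr2n [RHS]addrACA !addrA.
Qed.

(** The second iterate reads only the components in [M] and takes values in [A]. Elements [T u] have
    no component in [M], so one more bracket kills all its terms. *)
Lemma bracket_T_nilpotent k : iter k.+3 D pi = 0.
Proof.
elim: k => [|k IHk]; rewrite iterS.
  rewrite bracket_T2 bracket10E; apply/funext => -[|u [|v [|w s]]] //=.
  by congr pair;
    rewrite /= !(linear0, linear0l, linear0r, addr0, subr0, mul0rn).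
rewrite IHk bracket10E; apply/funext => -[|u [|v [|w s]]] //=.
by congr pair; rewrite /= linear0 ?addr0 ?subr0.
Qed.

(** This is half of the degree condition on the Maurer-Cartan element: the shift puts [L'_1] in
    degree 0. *)
Lemma structure_Lprime : Lprime 1 pi.
Proof.
rewrite structureE; split; first split.
- by case=> [|u [|v [|w s]]].
- move=> [|x [|? ?]] [|y [|? ?]] c u v //= _.
  + by congr pair; rewrite /= !linearPl ?linearPr //= scalerDr addrACA.
  + by congr pair; rewrite /= !linearPr ?linearPl //= scalerDr addrACA.
(* The words of length 2 with at most one [M] are [AA], [AM] and [MA]; their blocks are the lifts of
   [mu], [l] and [r]. *)
rewrite (bigD1 [tuple false; false]) //= (bigD1 [tuple false; true]) //=.
rewrite (bigD1 [tuple true; false]) //= big1 => [|w]; last first.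
  case/tupleP: w => b w; case/tupleP: w => b' w; rewrite (tuple0 w).
  by case: b; case: b'.
have addE (g h : seq V -> V) s : (g + h) s = g s + h s by [].
apply/funext => s; rewrite !addE /block /=.
case: s => [|u [|v [|w s]]] //=; rewrite ?addr0 //.
by congr pair; rewrite /= ?linear0l ?linear0r ?addr0 ?add0r.
Qed.

Lemma operator_afrak : afrak 0 t.
Proof.
split; first split.
- by case=> [|u [|v s]].
- by move=> [|? ?] [|? ?] c u v //= _; congr pair;
    rewrite /= ?linearP ?scaler0 ?addr0.
by apply/funext => -[|u [|v s]].
Qed.

(** Here [pi] is the product on [A (+) M] for which [M] has square zero, and [circ 1 1 pi pi] is its
    associator. The position of the argument taken from [M] selects the bimodule axiom. *)
Lemma circ_structureP :
  circ 1 1 pi pi = 0 <->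
  [/\ forall a b c, mu (mu a b) c = mu a (mu b c),
      forall a b m, l (mu a b) m = l a (l b m),
      forall a m b, r (l a m) b = l a (r m b) &
      forall m a b, r (r m a) b = r m (mu a b)].
Proof.
rewrite circ11E structureE; split=> [H | [assoc lA mid rA]].
  have {}H u v w : _ := congr1 (fun f => f [:: u; v; w]) H.
  rewrite /= in H; split=> a b c.
  - have /(congr1 fst)/eqP := H (a, 0) (b, 0) (c, 0).
    by rewrite subr_eq0 => /eqP.
  - have /(congr1 snd)/eqP := H (a, 0) (b, 0) (0, c).
    by rewrite subr_eq0 /= !(linear0l, linear0r, addr0, add0r) => /eqP.
  - have /(congr1 snd)/eqP := H (a, 0) (0, b) (c, 0).
    by rewrite subr_eq0 /= !(linear0l, linear0r, addr0, add0r) => /eqP.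
  - have /(congr1 snd)/eqP := H (0, a) (b, 0) (c, 0).
    by rewrite subr_eq0 /= !(linear0l, linear0r, addr0, add0r) => /eqP.
apply/funext => -[|u [|v [|w [|x s]]]] //=.
congr pair; rewrite /= ?assoc ?subrr //.
by rewrite linearDl linearDr /= lA mid rA addrA subrr.
Qed.

Lemma projP_bracket_T2P :
  [pchar K] =i pred0 ->
  projP (iter 2 D pi) = 0 <->
  forall m n, mu (T m) (T n) = T (l (T m) n + r m (T n)).
Proof.
move=> charK0; rewrite bracket_T2; split=> [H m n | H].
  have /(congr1 fst)/= := congr1 (fun f => f [:: (0, m); (0, n)]) H.
  rewrite -scaler_nat => /eqP.
  (* Characteristic 0 cancels the factor 2. *)
  by rewrite scaler_eq0 ((pcharf0P K).1 charK0) subr_eq0 => /eqP.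
apply/funext => -[|u [|v [|w s]]] //=.
- by rewrite /projP /block /= H subrr mul0rn.
- by rewrite /projP /block /= size_nseq eqxx.
Qed.

Lemma maurer_cartanE :
  [pchar K] =i pred0 ->
  maurer_cartan (W := rrb_linfinity A M) (pi, t) <->
  circ 1 1 pi pi = 0 /\ projP (iter 2 D pi) = 0.
Proof.
move=> charK0; have natK_neq0 := (pcharf0P K).1 charK0.
pose op k := gr_op (g := rrb_linfinity A M) (nseq k (0, (pi, t))).
have op1 : op 1 = 0 by [].
have op2 : op 2 = (- (circ 1 1 pi pi *+ 2), 0).
  congr pair; first exact: op_L_nseq2.
  (* On two arguments from [M] the first bracket takes values in [M], so its projection to [a]
     vanishes. *)
  rewrite op_a_nseq bracket_T1 (_ : projP _ = 0) ?mul0rn //.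
  apply/funext => -[|u [|v [|w s]]] //=; last first.
    by rewrite /projP /block /= size_nseq eqxx.
  rewrite /projP /block /=; congr pair => /=.
  by rewrite !(linear0l, linear0r, addr0, linear0, subr0).
have op3 : op 3 = (0, projP (iter 2 D pi) *+ 3) by congr pair; exact: op_a_nseq.
have op4 k : op k.+4 = 0.
  congr pair.
  by rewrite op_a_nseq bracket_T_nilpotent projP0 mul0rn.
have sumE N : (forall k, (N < k)%N -> op k = 0) ->
    \sum_(1 <= k < N.+1) (k`!%:R : K)^-1 *: op k =
    (- circ 1 1 pi pi, 2^-1 *: projP (iter 2 D pi)).
  move=> opN.
  (* The bound [N] may be smaller than 3; the range up to [3 + N.+1] contains both the given one and
     the indices 1 to 3, and all added terms vanish. *)
  transitivity (\sum_(1 <= k < 3 + N.+1) (k`!%:R : K)^-1 *: op k).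
    rewrite [RHS](big_cat_nat _ (n := N.+1)) ?leq_addl //=.
    rewrite [X in _ = _ + X]big_nat [X in _ = _ + X]big1 ?addr0 // => k.
    by case/andP => ltNk _; rewrite opN ?scaler0.
  rewrite (big_cat_nat _ (n := 4)) ?addnS //=.
  rewrite [X in _ + X = _]big_nat [X in _ + X = _]big1 => [|[|[|[|[|k]]]] // _];
    last by rewrite op4 scaler0.
  rewrite addr0 2?big_nat_recr //= big_nat1 op1 op2 op3.
  rewrite scaler0 !add0r; congr pair => /=.
    rewrite scaler0 addr0 scalerN -scaler_nat scalerA mulVf ?scale1r //.
    by rewrite natK_neq0.
  rewrite scaler0 add0r -scaler_nat scalerA; congr (_ *: _).
  (* The 3 equal terms of [l_3] divided by [3! = 2 * 3] leave the coefficient 1/2. *)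
  by rewrite (natrM _ 2 3) invfM mulfVK // natK_neq0.
rewrite /maurer_cartan -/op.
split=> [[_ [N [opN]]] | [circ0 proj0]].
  rewrite -/op sumE // => -[/eqP]; rewrite oppr_eq0 => /eqP -> /eqP.
  by rewrite scaler_eq0 invr_eq0 natK_neq0 => /eqP ->.
split; first by split; [exact: structure_Lprime | exact: operator_afrak].
exists 3; split=> [[|[|[|[|k]]]] // _|]; first exact: op4.
rewrite sumE; last by case=> [|[|[|[|k]]]].
by rewrite circ0 proj0 oppr0 scaler0.
Qed.

End RotaBaxter.

Theorem theorem4p3 (K : fieldType) (charK0 : [pchar K] =i pred0)
    (A M : lmodType K)
    (mu : {bilinear A -> A -> A}) (l : {bilinear A -> M -> M})
    (r : {bilinear M -> A -> M}) (T : {linear M -> A}) :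
  relative_rota_baxter mu l r T <->
  maurer_cartan (W := rrb_linfinity A M)
    (lift_mu mu + lift_l l + lift_r r, lift_T T).
Proof.
rewrite maurer_cartanE // circ_structureP projP_bracket_T2P //.
by split=> [[] | [[]]].
Qed.
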